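(* Let $\Lambda$ be a commutative discrete valuation ring. Let $X=(A\subset B)$ be an embedding of $\Lambda$-modules, where $B$ has type $\beta$, with socle tableau $\Sigma$, and let $\Gamma^*$ be the LR-tableau of the dual embedding $X^*$. For natural numbers $\ell,m\ge1$, the number $\mu_{\Gamma^*}(\ell,m)$ of entries $\ell$ in row $m$ of $\Gamma^*$ is $$\mu_{\Gamma^*}(\ell,m)=\begin{cases}0 & \text{if } m<\ell,\\[1ex] \displaystyle\beta'_m-\sum_{j\ge m}\mu_\Sigma(1,j) & \text{if } m=\ell,\\[1ex] \displaystyle\sum_{j>\ell}\mu_\Sigma(m-\ell,j)-\sum_{j\ge\ell}\mu_\Sigma(m-\ell+1,j) & \text{if } m>\ell,\end{cases}$$ where $\mu_\Sigma(e,j)$ denotes the number of entries $e$ in row $j$ of $\Sigma$.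
   Context: Let $p$ be a generator of the maximal ideal of $\Lambda$. All $\Lambda$-modules have finite length. For a partition $\lambda=(\lambda_1\ge\dots\ge\lambda_n\geq 1)$ put $N_\lambda=\Lambda/(p^{\lambda_1})\oplus\cdots\oplus\Lambda/(p^{\lambda_n})$; a $\Lambda$-module $M$ has type $\lambda$ if $M\cong N_\lambda$. $\lambda'$ is the transpose, $\lambda'_i=\#\{j:\lambda_j\ge i\}$. The Young diagram of $\lambda$ has columns of lengths $\lambda_1,\lambda_2,\dots$; rows are numbered from top to bottom, so row $i$ has length $\lambda'_i$. An embedding $(A\subset B)$ consists of a $\Lambda$-module $B$ and a submodule $A$. $\mathrm{soc}^\ell A=\{a\in A:p^\ell a=0\}$. Let $A,B,B/A$ have types $\alpha,\beta,\gamma$. The socle tableau of $(A\subset B)$ is given by the decreasing sequence $(\sigma^{(i)})$, $\sigma^{(i)}$ the type of $B/\mathrm{soc}^iA$; as a filling of $\beta\setminus\gamma$, the boxes of $\sigma^{(\ell-1)}\setminus\sigma^{(\ell)}$ have entry $\ell$. The LR-tableau of $(A\subset B)$ is given by the increasing sequence $(\gamma^{(i)})$, $\gamma^{(i)}$ the type of $B/p^iA$; the boxes of $\gamma^{(\ell)}\setminus\gamma^{(\ell-1)}$ have entry $\ell$. Let $E$ be the injective envelope of $\Lambda/(p)$ and $DM=\mathrm{Hom}_\Lambda(M,E)$. With $C=B/A$ and $\pi:B\to C$ canonical, the dual embedding $X^*$ is the inclusion $\mathrm{Hom}_\Lambda(\pi,E):DC\to DB$. *)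

(* Defs.v *)
From HB Require Import structures.
From mathcomp Require Import all_boot all_order all_algebra.
From mathcomp Require Import generic_quotient ring_quotient.
From mathcomp Require Import all_classical.

Set Implicit Arguments.
Unset Strict Implicit.
Unset Printing Implicit Defensive.

Import GRing.Theory.
Local Open Scope ring_scope.
Local Open Scope quotient_scope.
Local Open Scope classical_set_scope.

(* Submodules are the [submodClosed M] predicates of ssralg. *)

Section QuotientModule.
Variables (R : idomainType) (M : lmodType R) (A : submodClosed M).

Fact submod_zmod_closed : zmod_closed (A : {pred M}).
Proof. exact: (GRing.submod_closedB (submodClosedP A)). Qed.

Definition submod_pred : {pred M} := A.
HB.instance Definition _ := GRing.isZmodClosed.Build M submod_pred
  submod_zmod_closed.

Definition quotmod : Type := {ideal_quot submod_pred}.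
HB.instance Definition _ := GRing.Zmodule.on quotmod.
HB.instance Definition _ := ZmodQuotient.on quotmod.

Definition quotmod_proj (x : M) : quotmod := \pi_quotmod x.

Lemma quotmod_projE (x y : M) :
  (quotmod_proj x = quotmod_proj y) <-> (x - y \in A).
Proof.
split=> [/eqP|h]; last apply/eqP; by rewrite /quotmod_proj -Quotient.idealrBE.
Qed.

Lemma quotmod_proj_surj (u : quotmod) : exists x, u = quotmod_proj x.
Proof. by exists (repr u); rewrite /quotmod_proj reprK. Qed.

Fact quotmod_proj_zmod_morphism : zmod_morphism quotmod_proj.
Proof. by move=> x y; rewrite /quotmod_proj raddfB. Qed.
HB.instance Definition _ := GRing.isZmodMorphism.Build M quotmod quotmod_proj
  quotmod_proj_zmod_morphism.

Definition quotmod_scale (a : R) (u : quotmod) : quotmod :=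
  quotmod_proj (a *: repr u).

Fact quotmod_scaleE a x :
  quotmod_scale a (quotmod_proj x) = quotmod_proj (a *: x).
Proof.
apply/quotmod_projE; rewrite -scalerBr; apply: rpredZ.
by apply/quotmod_projE; rewrite /quotmod_proj reprK.
Qed.

Fact quotmod_scaleA a b u :
  quotmod_scale a (quotmod_scale b u) = quotmod_scale (a * b) u.
Proof.
by have [x ->] := quotmod_proj_surj u; rewrite !quotmod_scaleE scalerA.
Qed.

Fact quotmod_scale1 : left_id 1 quotmod_scale.
Proof.
by move=> u; have [x ->] := quotmod_proj_surj u; rewrite quotmod_scaleE scale1r.
Qed.

Fact quotmod_scaleDr : right_distributive quotmod_scale +%R.
Proof.
move=> a u v; have [x ->] := quotmod_proj_surj u.
have [y ->] := quotmod_proj_surj v.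
by rewrite -raddfD !quotmod_scaleE scalerDr raddfD.
Qed.

Fact quotmod_scaleDl u : {morph quotmod_scale^~ u : a b / a + b}.
Proof.
move=> a b; have [x ->] := quotmod_proj_surj u.
by rewrite !quotmod_scaleE scalerDl raddfD.
Qed.

HB.instance Definition _ := GRing.Zmodule_isLmodule.Build R quotmod
  quotmod_scaleA quotmod_scale1 quotmod_scaleDr quotmod_scaleDl.

Fact quotmod_proj_scalable : scalable quotmod_proj.
Proof. by move=> a x; rewrite -quotmod_scaleE. Qed.
HB.instance Definition _ := GRing.isScalable.Build R M quotmod *:%R
  quotmod_proj quotmod_proj_scalable.

End QuotientModule.

Arguments quotmod_proj {R M} A.

Section Submodules.
Variable R : idomainType.

(* (a), as a submodule of the regular module R^o *)
Definition principal (a : R) : {pred R^o} :=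
  [pred x : R^o | `[< exists c : R, x = c * a >]].

Fact principal_closed a : submod_closed (principal a).
Proof.
split; first by apply/asboolP; exists 0; rewrite mul0r.
move=> b x y /asboolP[c ->] /asboolP[d ->]; apply/asboolP.
by exists (b * c + d); rewrite mulrDl -mulrA.
Qed.
HB.instance Definition _ a := GRing.isSubmodClosed.Build R R^o (principal a)
  (principal_closed a).

(* soc^i A *)
Definition socle (p : R) (i : nat) (M : lmodType R) (A : submodClosed M)
  : {pred M} := [pred x | (x \in A) && (p ^+ i *: x == 0)].

Fact socle_closed p i M A : submod_closed (@socle p i M A).
Proof.
split; first by rewrite inE /= rpred0 scaler0 eqxx.
move=> a x y /andP[xA /eqP px] /andP[yA /eqP py]; rewrite inE /=.
rewrite rpredD ?rpredZ //= scalerDr scalerA mulrC -scalerA px py.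
by rewrite scaler0 addr0.
Qed.
HB.instance Definition _ p i M A := GRing.isSubmodClosed.Build R M
  (@socle p i M A) (@socle_closed p i M A).

(* p^i A *)
Definition power_mul (p : R) (i : nat) (M : lmodType R) (A : submodClosed M)
  : {pred M} := [pred x | `[< exists2 a, a \in A & x = p ^+ i *: a >]].

Fact power_mul_closed p i M A : submod_closed (@power_mul p i M A).
Proof.
split; first by apply/asboolP; exists 0; rewrite ?rpred0 ?scaler0.
move=> a x y /asboolP[u uA ->] /asboolP[v vA ->]; apply/asboolP.
exists (a *: u + v); first by rewrite rpredD ?rpredZ.
by rewrite scalerDr !scalerA mulrC.
Qed.
HB.instance Definition _ p i M A := GRing.isSubmodClosed.Build R M
  (@power_mul p i M A) (@power_mul_closed p i M A).

Definition lin_image (M N : lmodType R) (f : {linear M -> N}) : {pred N} :=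
  [pred y | `[< exists x, y = f x >]].

Fact lin_image_closed M N f : submod_closed (@lin_image M N f).
Proof.
split; first by apply/asboolP; exists 0; rewrite linear0.
move=> a x y /asboolP[u ->] /asboolP[v ->]; apply/asboolP.
by exists (a *: u + v); rewrite linearP.
Qed.
HB.instance Definition _ M N f := GRing.isSubmodClosed.Build R N
  (@lin_image M N f) (@lin_image_closed M N f).

End Submodules.

Section DiscreteValuationRing.
Variable R : idomainType.

(* Ideals of R are the submodules of R^o. *)

Definition is_pid : Prop :=
  forall I : submodClosed R^o, exists a : R, I =i principal a.

Definition maximal_ideal (m : submodClosed R^o) : Prop :=
  (1 : R) \notin m /\
  forall I : submodClosed R^o, {subset m <= I} -> (1 : R) \notin I -> I =i m.

(* a local principal ideal domain which is not a field *)
Definition is_dvr : Prop :=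
  is_pid /\
  exists m : submodClosed R^o,
    [/\ maximal_ideal m,
        forall m' : submodClosed R^o, maximal_ideal m' -> m' =i m
      & exists2 x : R, x \in m & x != 0].

Definition generates_maximal_ideal (p : R) : Prop :=
  exists2 m : submodClosed R^o, maximal_ideal m & m =i principal p.

End DiscreteValuationRing.

Section HomModule.
Variables (R : idomainType) (E M : lmodType R).

(* DM = Hom_R(M, E) *)
Definition dual : Type := {linear M -> E}.
HB.instance Definition _ := gen_eqMixin dual.
HB.instance Definition _ := gen_choiceMixin dual.

Definition dual_fun (f : dual) : M -> E :=
  let f' : {linear M -> E} := f in f'.

Lemma dualP (f g : dual) : dual_fun f =1 dual_fun g -> f = g.
Proof.
case: f g => [f cf] [g cg] /= /funext e; move: cf cg; rewrite e => cf cg.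
case: cf cg => [[f1] [f2]] [[g1] [g2]].
by rewrite (Prop_irrelevance f1 g1) (Prop_irrelevance f2 g2).
Qed.

Definition dual0 : dual := (\0 : M -> E) : {linear M -> E}.
Definition dual_opp (f : dual) : dual :=
  let f' : {linear M -> E} := f in (\- f')%R : {linear M -> E}.
Definition dual_add (f g : dual) : dual :=
  let f' : {linear M -> E} := f in let g' : {linear M -> E} := g in
  (f' \+ g')%R : {linear M -> E}.
Definition dual_scale (a : R) (f : dual) : dual :=
  let f' : {linear M -> E} := f in (a \*: f')%R : {linear M -> E}.

Fact dual_addA : associative dual_add.
Proof. by move=> f g h; apply: dualP => x /=; exact: addrA. Qed.
Fact dual_addC : commutative dual_add.
Proof. by move=> f g; apply: dualP => x /=; exact: addrC. Qed.
Fact dual_add0 : left_id dual0 dual_add.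
Proof. by move=> f; apply: dualP => x /=; exact: add0r. Qed.
Fact dual_addN : left_inverse dual0 dual_opp dual_add.
Proof. by move=> f; apply: dualP => x /=; exact: addNr. Qed.
HB.instance Definition _ := GRing.isZmodule.Build dual
  dual_addA dual_addC dual_add0 dual_addN.

Fact dual_scaleA a b f : dual_scale a (dual_scale b f) = dual_scale (a * b) f.
Proof. by apply: dualP => x /=; exact: scalerA. Qed.
Fact dual_scale1 : left_id 1 dual_scale.
Proof. by move=> f; apply: dualP => x /=; exact: scale1r. Qed.
Fact dual_scaleDr : right_distributive dual_scale +%R.
Proof. by move=> a f g; apply: dualP => x /=; exact: scalerDr. Qed.
Fact dual_scaleDl f : {morph dual_scale^~ f : a b / a + b}.
Proof. by move=> a b; apply: dualP => x /=; exact: scalerDl. Qed.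
HB.instance Definition _ := GRing.Zmodule_isLmodule.Build R dual
  dual_scaleA dual_scale1 dual_scaleDr dual_scaleDl.

End HomModule.

Section DualMap.
Variables (R : idomainType) (E M N : lmodType R) (f : {linear M -> N}).

(* Hom_R(f, E) : DN -> DM *)
Definition dual_map (phi : dual E N) : dual E M :=
  let phi' : {linear N -> E} := phi in (phi' \o f) : {linear M -> E}.

Fact dual_map_linear : linear dual_map.
Proof. by move=> a phi psi; apply: dualP. Qed.
HB.instance Definition _ := GRing.isLinear.Build R (dual E N) (dual E M) *:%R
  dual_map dual_map_linear.

End DualMap.

Arguments dual_map {R} E {M N} f.

Section InjectiveEnvelope.
Variable R : idomainType.

Definition injective_module (E : lmodType R) : Prop :=
  forall (M N : lmodType R) (i : {linear M -> N}) (f : {linear M -> E}),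
    injective i -> exists g : {linear N -> E}, forall x, g (i x) = f x.

Definition essential_mono (M E : lmodType R) (i : {linear M -> E}) : Prop :=
  injective i /\
  forall S : submodClosed E, (exists2 x, x \in S & x != 0) ->
    exists2 x, x \in S & x != 0 /\ x \in lin_image i.

Definition injective_envelope (M E : lmodType R) : Prop :=
  injective_module E /\ exists i : {linear M -> E}, essential_mono i.

End InjectiveEnvelope.

Section Types.
Variable R : idomainType.

Definition is_partition (l : seq nat) : bool :=
  sorted geq l && all (leq 1) l.

(* N_l, with the zero module as the empty direct sum *)
Fixpoint std_module (p : R) (l : seq nat) : lmodType R :=
  if l is a :: l' then
    (quotmod (principal (p ^+ a)) * std_module p l')%type : lmodType R
  else 'rV[R]_0 : lmodType R.

Definition lmod_iso (M N : lmodType R) : Prop :=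
  exists f : {linear M -> N}, bijective f.

Definition has_type (p : R) (M : lmodType R) (l : seq nat) : Prop :=
  is_partition l /\ lmod_iso M (std_module p l).

End Types.

(* the transpose: conj_part l i is the i-th part of l', for i >= 1 *)
Definition conj_part (l : seq nat) (i : nat) : nat := count (leq i) l.

(* The parts of l are the columns of its diagram. Rows are numbered from 1,
   columns from 0. *)
Definition in_diagram (l : seq nat) (row col : nat) : bool :=
  (col < size l)%N && (0 < row <= nth 0%N l col)%N.

(* number of boxes of [outer \ inner] in a row *)
Definition skew_row (outer inner : seq nat) (row : nat) : nat :=
  count (fun col => in_diagram outer row col && ~~ in_diagram inner row col)
    (iota 0 (size outer)).

Record embedding (R : idomainType) := Embedding {
  ambient : lmodType R;
  submod : submodClosed ambient
}.

Section Tableaux.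
Variables (R : idomainType) (p : R).

Definition is_socle_tableau (X : embedding R) (sigma : nat -> seq nat) : Prop :=
  forall i, has_type p (quotmod (socle p i (submod X))) (sigma i).

Definition is_LR_tableau (X : embedding R) (gamma : nat -> seq nat) : Prop :=
  forall i, has_type p (quotmod (power_mul p i (submod X))) (gamma i).

(* X^* *)
Definition dual_embedding (E : lmodType R) (X : embedding R) : embedding R :=
  @Embedding R (dual E (ambient X))
    (lin_image (dual_map E (quotmod_proj (submod X)))).

End Tableaux.

(* Number of entries e >= 1 in a row of a tableau. A socle tableau is a
   decreasing sequence of partitions, an LR-tableau an increasing one. *)
Definition mu_socle (sigma : nat -> seq nat) (e row : nat) : nat :=
  skew_row (sigma e.-1) (sigma e) row.

Definition mu_LR (gamma : nat -> seq nat) (e row : nat) : nat :=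
  skew_row (gamma e) (gamma e.-1) row.

(* The sums below range over all j >= k. The finite-support convention of fsbigop
   is harmless: mu_socle sigma e has finite support. *)
Definition mu_socle_from (sigma : nat -> seq nat) (e k : nat) : int :=
  \sum_(j \in [set j : nat | (k <= j)%N]) (mu_socle sigma e j)%:Z.

Lemma skew_row_eq0 (outer inner : seq nat) (j : nat) :
  (\max_(a <- outer) a < j)%N -> skew_row outer inner j = 0%N.
Proof.
move=> hj; apply/eqP; rewrite -leqn0 leqNgt -has_count; apply/hasPn => c _.
apply/negP => /andP[/andP[hc /andP[_ hj']] _].
move: hj; rewrite ltnNge => /negP; apply; apply: (leq_trans hj').
by apply: (@leq_bigmax_seq _ _ xpredT id); rewrite ?mem_nth.
Qed.

Lemma mu_socle_finite (sigma : nat -> seq nat) (e k : nat) :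
  finite_set ([set j | (k <= j)%N] `&`
    (fun j => (mu_socle sigma e j)%:Z) @^-1` [set~ 0]).
Proof.
apply: (@sub_finite_set _ _ `I_((\max_(a <- sigma e.-1) a).+1)).
  move=> j [_ /= h]; rewrite ltnNge; apply/negP => hj.
  by apply: h; rewrite /mu_socle skew_row_eq0.
exact: finite_II.
Qed.

(* Main.v *)
(** Write [soc M] for the elements of [M] killed by [p], and [len] for the length
    of a module. If [M] has type [l] then the part [k+1] of the transpose of [l] is
    [len (soc (p^k M)) = len (p^k M) - len (p^(k+1) M)].

    Socle tableau: applied to [M = B / soc^e A], this shows that row [k+1] contains
    [v e k - v e (k+1)] entries [e+1], where
    [v e k = len (p^e (soc^(e+1) (A :&: p^k B)))]; the sums over rows telescope.

    Dual LR-tableau: [p^l DC] is the annihilator in [DB] of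
    [A_l = {b | p^l b \in A}], and a submodule [T] of [B] and its annihilator have
    lengths adding up to [len B]. Since [p^k f] kills [A_l] iff [f] kills [p^k A_l],
    [p^k (DB / p^l DC)] has the length of [p^k A_l], so that the part [k+1] of the
    transpose of [gamma l] is [w l k = len (soc (p^k A_l))].

    Finally [soc (p^k A_l)] is [soc (p^k B)] if [k < l], and
    [w l (l + e) = v e l]. *)

From HB Require Import structures.
Require Import Defs.
From mathcomp Require Import all_boot all_order all_algebra all_classical.
From mathcomp Require Import zify.

Set Implicit Arguments.
Unset Strict Implicit.
Unset Printing Implicit Defensive.

Import GRing.Theory.
Local Open Scope ring_scope.

(** * Submodules cut out by predicates: kernels, images, inverse images *)

Section SubmodOf.
Variables (R : idomainType) (M : lmodType R).

Lemma submodB (S : submodClosed M) x y : x \in S -> y \in S -> x - y \in S.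
Proof. by case: (submod_zmod_closed S) => _; apply. Qed.

Lemma submodB_cancel (S : submodClosed M) x y :
  x - y \in S -> y \in S -> x \in S.
Proof. by move=> xyS yS; rewrite -(subrK y x) rpredD. Qed.

Definition lin_closed (P : M -> Prop) : Prop :=
  P 0 /\ forall (a : R) x y, P x -> P y -> P (a *: x + y).

(** The closure proof is an argument so that the submodule structure can be inferred from the term
    itself. *)
Definition pred_of (P : M -> Prop) of lin_closed P : {pred M} :=
  [pred x | `[< P x >]].

Fact pred_of_closed P (h : lin_closed P) : submod_closed (pred_of h).
Proof.
case: (h) => h0 hD; split; first exact/asboolP.
by move=> a x y /asboolP Px /asboolP Py; apply/asboolP; apply: hD.
Qed.
HB.instance Definition _ P h := GRing.isSubmodClosed.Build R M (@pred_of P h)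
  (pred_of_closed h).

Definition submod_of P (h : lin_closed P) : submodClosed M := pred_of h.

Lemma submod_ofP P (h : lin_closed P) x : reflect (P x) (x \in submod_of h).
Proof. exact: asboolP. Qed.

End SubmodOf.

Section Constructions.
Variables (R : idomainType) (M N : lmodType R).
Implicit Types (S T : submodClosed M) (U : submodClosed N).
Implicit Types (f : {linear M -> N}).

Fact full_closed : lin_closed (fun _ : M => True).
Proof. by []. Qed.
Definition full := submod_of full_closed.

Lemma in_full x : x \in full.
Proof. exact/submod_ofP. Qed.

Fact cyclic_closed x : lin_closed (fun y : M => exists c : R, y = c *: x).
Proof.
split; first by exists 0; rewrite scale0r.
move=> a _ _ [c ->] [d ->]; exists (a * c + d).
by rewrite scalerDl scalerA.
Qed.
Definition cyclic x := submod_of (cyclic_closed x).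

Fact extension_closed T x :
  lin_closed (fun y => exists c : R, y - c *: x \in T).
Proof.
split; first by exists 0; rewrite scale0r subr0 rpred0.
move=> a y z [c hc] [d hd]; exists (a * c + d).
have -> : a *: y + z - (a * c + d) *: x = a *: (y - c *: x) + (z - d *: x).
  by rewrite scalerDl scalerBr scalerA opprD addrACA.
by rewrite rpredD ?rpredZ.
Qed.
Definition extension T x := submod_of (extension_closed T x).

Fact inverse_image_closed f S U : lin_closed (fun x => x \in S /\ f x \in U).
Proof.
split; first by rewrite linear0 !rpred0.
by move=> a x y [xS fx] [yS fy]; rewrite linearP !rpredD ?rpredZ.
Qed.
Definition inverse_image f S U := submod_of (inverse_image_closed f S U).

Lemma in_inverse_image f S U x :
  (x \in inverse_image f S U) = (x \in S) && (f x \in U).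
Proof. by apply/submod_ofP/andP. Qed.

Fact kernel_closed f S : lin_closed (fun x => x \in S /\ f x = 0).
Proof.
split; first by rewrite linear0 !rpred0.
move=> a x y [xS fx] [yS fy]; split; first by rewrite rpredD ?rpredZ.
by rewrite linearP fx fy scaler0 addr0.
Qed.
Definition kernel f S := submod_of (kernel_closed f S).

Lemma in_kernel f S x : (x \in kernel f S) = (x \in S) && (f x == 0).
Proof.
by apply/submod_ofP/andP=> [[? ->]|[? /eqP]].
Qed.

Fact img_closed f S : lin_closed (fun y => exists2 x, x \in S & y = f x).
Proof.
split; first by exists 0; rewrite ?linear0 ?rpred0.
move=> a _ _ [x xS ->] [y yS ->]; exists (a *: x + y).
  by rewrite rpredD ?rpredZ.
by rewrite linearP.
Qed.
Definition img f S := submod_of (img_closed f S).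

Lemma imgP f S y : reflect (exists2 x, x \in S & y = f x) (y \in img f S).
Proof. exact: submod_ofP. Qed.

Lemma mem_img f S x : x \in S -> f x \in img f S.
Proof. by move=> xS; apply/imgP; exists x. Qed.

End Constructions.

Arguments full {R} M.

(** * Length *)

Section Length.
Variable R : idomainType.
Implicit Type M : lmodType R.

(** A strictly descending chain with [n] steps that starts at [S] and may stop anywhere. Length is
    the largest number of steps, so additivity can be proved by splitting and joining chains,
    without composition series. *)
Fixpoint has_chain n M (S : submodClosed M) : Prop :=
  if n is n'.+1 then
    exists2 T : submodClosed M,
      {subset T <= S} /\ (exists2 x, x \in S & x \notin T) & has_chain n' T
  else True.

Definition has_length M (S : submodClosed M) (n : nat) : Prop :=
  forall k, has_chain k S <-> (k <= n)%N.

Definition finite_length M (S : submodClosed M) : Prop :=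
  exists n, has_length S n.

(** The default value on infinite length is [0]; hence the finiteness hypotheses in [len_le] and
    [len_add]. *)
Definition len M (S : submodClosed M) : nat := xget 0%N [set n | has_length S n].

Lemma has_chain_mono n M (S T : submodClosed M) :
  {subset S <= T} -> has_chain n S -> has_chain n T.
Proof.
case: n => //= n ST [U [US [x xS xU]] cU]; exists U => //.
split; first by move=> y /US/ST.
by exists x => //; apply: ST.
Qed.

Lemma has_chainS n M (S : submodClosed M) : has_chain n.+1 S -> has_chain n S.
Proof. by case=> T [TS _]; apply: has_chain_mono. Qed.

Lemma has_chain_le k n M (S : submodClosed M) :
  (k <= n)%N -> has_chain n S -> has_chain k S.
Proof.
elim: n => [|n IHn]; first by rewrite leqn0 => /eqP->.
by rewrite leq_eqVlt => /predU1P[-> //|/IHn h /has_chainS].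
Qed.

Lemma has_length_unique M (S : submodClosed M) n n' :
  has_length S n -> has_length S n' -> n = n'.
Proof.
move=> h h'; apply/eqP; rewrite eqn_leq.
by apply/andP; split; [apply/h'/h|apply/h/h'].
Qed.

Lemma has_length_len M (S : submodClosed M) n : has_length S n -> len S = n.
Proof.
move=> h; apply: xget_unique => // n' h'; exact: has_length_unique h' h.
Qed.

Lemma lenP M (S : submodClosed M) : finite_length S -> has_length S (len S).
Proof. by case=> n h; rewrite (has_length_len h). Qed.

Lemma finite_lengthW n M (S : submodClosed M) :
  ~ has_chain n S -> finite_length S.
Proof.
elim: n => [|n IHn] hn; first by case: hn.
have [cn|/IHn//] := pselect (has_chain n S).
exists n => k; split=> [ck|kn]; last exact: has_chain_le kn cn.
by rewrite leqNgt; apply/negP => /has_chain_le/(_ ck).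
Qed.

Lemma finite_length_sub M (S T : submodClosed M) :
  {subset S <= T} -> finite_length T -> finite_length S.
Proof.
move=> ST [n h]; apply: (@finite_lengthW n.+1) => /(has_chain_mono ST)/h.
by rewrite ltnn.
Qed.

Lemma finite_length_submod M (S : submodClosed M) :
  finite_length (full M) -> finite_length S.
Proof. by apply: finite_length_sub => x _; exact: in_full. Qed.

Lemma len_le M (S T : submodClosed M) :
  {subset S <= T} -> finite_length T -> (len S <= len T)%N.
Proof.
move=> ST fT; apply/(lenP fT)/(has_chain_mono ST).
exact/(lenP (finite_length_sub ST fT)).
Qed.

Lemma has_length_eq M (S T : submodClosed M) n :
  S =i T -> has_length S n -> has_length T n.
Proof.
by move=> ST h k; rewrite -h; split; apply: has_chain_mono => x; rewrite ST.
Qed.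

Lemma eq_len M (S T : submodClosed M) : S =i T -> len S = len T.
Proof.
move=> ST; congr xget; apply/funext => n; apply/propext.
by split; apply: has_length_eq => // x; rewrite ST.
Qed.

Lemma has_length0 M (S : submodClosed M) :
  (forall x, x \in S -> x = 0) -> has_length S 0.
Proof.
move=> S0 [|k] //=; split=> // -[T [TS [x /S0-> /negP[]]]].
exact: rpred0.
Qed.

Section Additivity.
Variables (M N : lmodType R) (f : {linear M -> N}).
Implicit Type S : submodClosed M.

(** Each strict step from [S] to [T] stays strict in the image or in the kernel: for [s] in [S]
    outside [T], either [f s] is not in the image of [T], or [f s = f t] with [t] in [T], and then
    [s - t] lies in the kernel and outside [T]. *)
Lemma has_chain_split n S : has_chain n S ->
  exists a b, [/\ (a + b)%N = n, has_chain a (img f S)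
                & has_chain b (kernel f S)].
Proof.
elim: n S => [|n IHn] S /=; first by exists 0%N, 0%N.
case=> T [TS [s sS sT]] /IHn[a [b [<- ca cb]]].
have iTS : {subset img f T <= img f S}.
  by move=> _ /imgP[x xT ->]; apply/mem_img/TS.
have kTS : {subset kernel f T <= kernel f S}.
  by move=> x; rewrite !in_kernel => /andP[/TS-> ->].
have [fsT|fsT] := boolP (f s \in img f T); last first.
  exists a.+1, b; split=> //; last exact: has_chain_mono cb.
  exists (img f T) => //; split=> //; exists (f s) => //; exact: mem_img.
exists a, b.+1; split; [by rewrite addnS|exact: has_chain_mono ca|].
exists (kernel f T) => //; split=> //.
have /imgP[t tT fst] := fsT; exists (s - t).
  rewrite in_kernel linearB fst subrr eqxx andbT; apply: submodB => //.
  exact: TS.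
rewrite in_kernel negb_and; apply/orP; left; apply: contra sT => stT.
exact: submodB_cancel stT tT.
Qed.

(** Inverse images turn a chain in the image into a chain of submodules that all contain the kernel,
    so the chain of the kernel can be appended below it. *)
Lemma has_chain_cat a b S : has_chain a (img f S) ->
  has_chain b (kernel f S) -> has_chain (a + b) S.
Proof.
elim: a S => [|a IHa] S.
  by move=> _ cb; apply: has_chain_mono cb => x; rewrite in_kernel => /andP[].
case=> U [US [_ /imgP[s sS ->] fsU]] ca cb; exists (inverse_image f S U).
  split; first by move=> x; rewrite in_inverse_image => /andP[].
  by exists s => //; rewrite in_inverse_image sS.
apply: IHa.
  apply: has_chain_mono ca => y yU; have /imgP[x xS def_y] := US y yU.
  by apply/imgP; exists x => //; rewrite in_inverse_image xS -def_y.
apply: has_chain_mono cb => x; rewrite !in_kernel in_inverse_image.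
case/andP=> -> /eqP->.
by rewrite rpred0 eqxx.
Qed.

Lemma has_length_add S a b : has_length (img f S) a ->
  has_length (kernel f S) b -> has_length S (a + b).
Proof.
move=> ha hb k; split=> [/has_chain_split[i [j [<- /ha ia /hb jb]]]|hk].
  exact: leq_add.
by apply: (has_chain_le hk); apply: has_chain_cat; [apply/ha|apply/hb].
Qed.

Lemma finite_length_img S : finite_length S -> finite_length (img f S).
Proof.
case=> n h; apply: (@finite_lengthW n.+1) => c.
have /h := @has_chain_cat n.+1 0 S c I.
by rewrite addn0 ltnn.
Qed.

Lemma len_add S :
  finite_length S -> len S = (len (img f S) + len (kernel f S))%N.
Proof.
move=> fS; apply/has_length_len/has_length_add; apply: lenP.
  exact: finite_length_img.
by apply: finite_length_sub fS => x; rewrite in_kernel => /andP[].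
Qed.

End Additivity.

End Length.

(** * Socles of powers and types *)

Section Uniformizer.
Variables (R : idomainType) (p : R).

(** The form in which the discrete valuation ring enters: [p] is a nonzero nonunit, and maximality
    of its ideal is expressed as a Bezout relation. *)
Definition uniformizer : Prop :=
  [/\ p != 0, forall a, a * p != 1
    & forall c, (exists d, c = d * p) \/ exists a b, a * p + b * c = 1].

Lemma dvr_uniformizer :
  is_dvr R -> generates_maximal_ideal p -> uniformizer.
Proof.
case=> _ [m0 [_ uniq_m0 [x xm0 x0]]] [m m_max m_p]; split.
- apply: contra x0 => /eqP p0; move: xm0.
  by rewrite -(uniq_m0 m m_max) m_p => /asboolP[c ->]; rewrite p0 mulr0.
- move=> a; case: m_max => m1 _; apply: contra m1 => /eqP ap1.
  by rewrite m_p; apply/asboolP; exists a.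
move=> c; case: m_max => _ m_max.
(* Here [extension m c] is the ideal generated by [m] and [c]. If it contains 1, this is the Bezout
   relation; otherwise it equals [m] by maximality, and [p] divides [c]. *)
have [|c1] := boolP ((1 : R^o) \in extension m (c : R^o)).
  case/submod_ofP=> b; rewrite m_p => /asboolP[a eq_a]; right.
  by exists a, b; rewrite -eq_a subrK.
left; have mc : {subset m <= extension m (c : R^o)}.
  by move=> y ym; apply/submod_ofP; exists 0; rewrite scale0r subr0.
have : (c : R^o) \in extension m (c : R^o).
  by apply/submod_ofP; exists 1; rewrite scale1r subrr rpred0.
by rewrite (m_max _ mc c1) m_p => /asboolP.
Qed.

Section PowerSocle.
Variable M : lmodType R.
Implicit Types (S T : submodClosed M) (x y : M).

Lemma power_mulP i S x :
  reflect (exists2 y, y \in S & x = p ^+ i *: y) (x \in power_mul p i S).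
Proof. exact: asboolP. Qed.

Lemma in_socle i S x : (x \in socle p i S) = (x \in S) && (p ^+ i *: x == 0).
Proof. by []. Qed.

Lemma power_mulD i j S : power_mul p (i + j) S =i power_mul p i (power_mul p j S).
Proof.
move=> x; apply/power_mulP/power_mulP => [[y yS ->]|[_ /power_mulP[y yS ->] ->]].
  by exists (p ^+ j *: y); rewrite ?scalerA -?exprD //; apply/power_mulP; exists y.
by exists y; rewrite // scalerA exprD.
Qed.

Lemma len_power_socle i S : finite_length S ->
  len S = (len (power_mul p i S) + len (socle p i S))%N.
Proof.
move=> fS; rewrite (len_add ( *:%R (p ^+ i)) fS); congr (_ + _)%N; apply: eq_len.
  by move=> x; apply/imgP/power_mulP.
by move=> x; rewrite in_kernel in_socle.
Qed.

Lemma finite_length_power_mul i S :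
  finite_length S -> finite_length (power_mul p i S).
Proof.
by apply: finite_length_sub => _ /power_mulP[x xS ->]; rewrite rpredZ.
Qed.

Lemma len_power_mulS i S : finite_length S ->
  len (power_mul p i S) =
  (len (power_mul p i.+1 S) + len (socle p 1 (power_mul p i S)))%N.
Proof.
move=> fS; rewrite (len_power_socle 1 (finite_length_power_mul i fS)).
by congr (_ + _)%N; apply: eq_len => x; rewrite -(add1n i) power_mulD.
Qed.

(** If [y = c *: x] is nonzero, [p] does not divide [c], and the relation [a * p + b * c = 1]
    recovers [x] as [b *: y]. *)
Lemma cyclic_simple T x y : uniformizer -> p *: x = 0 ->
  y \in cyclic x -> y != 0 -> y \in T -> x \in T.
Proof.
case=> _ _ p_max px /submod_ofP[c ->] cx0 cxT.
have [[d def_c]|[a [b abc]]] := p_max c.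
  by rewrite def_c -scalerA px scaler0 eqxx in cx0.
have -> : x = b *: (c *: x).
  by rewrite -[LHS]scale1r -abc scalerDl -!scalerA px scaler0 add0r.
exact: rpredZ.
Qed.

Lemma has_length_cyclic x : uniformizer -> p *: x = 0 -> x != 0 ->
  has_length (cyclic x) 1.
Proof.
move=> up px x0 [|[|k]]; split=> //.
  move=> _; exists (cyclic 0) => //; split.
    by move=> y /submod_ofP[c ->]; rewrite scaler0 rpred0.
  exists x; first by apply/submod_ofP; exists 1; rewrite scale1r.
  by apply: contra x0 => /submod_ofP[c ->]; rewrite scaler0.
case=> T [Tx [y yx yT]] [U [UT [z zT zU]] _].
have z0 : z != 0 by apply: contraNneq zU => ->; exact: rpred0.
have xT := cyclic_simple up px (Tx z zT) z0 zT.
by case/submod_ofP: yx => c def_y; rewrite def_y rpredZ in yT.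
Qed.

End PowerSocle.

Definition power_socle k (M : lmodType R) : submodClosed M :=
  socle p 1 (power_mul p k (full M)).

Lemma power_socleP k (M : lmodType R) x :
  reflect (p *: x = 0 /\ exists y, x = p ^+ k *: y) (x \in power_socle k M).
Proof.
rewrite in_socle expr1; apply/(iffP andP) => -[].
  by move=> /power_mulP[y _ ->] /eqP; split=> //; exists y.
by move=> px [y def_x]; split; [apply/power_mulP; exists y; rewrite ?in_full|exact/eqP].
Qed.

(** For [a > 0] the socle of the cyclic module is simple, generated by the class of [p ^+ a.-1],
    which is a multiple of [p ^+ k] as soon as [k < a]. For [a <= k] the [k]-th power is already
    zero. *)
Lemma has_length_power_socle_principal k a : uniformizer ->
  has_length (power_socle k (quotmod (principal (p ^+ a)))) (k < a).
Proof.
move=> up; have [p0 p1 _] := up; 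
have [ka|ak] := ltnP k a; last first.
  apply: has_length0 => _ /power_socleP[_ [y ->]].
  have [x ->] := quotmod_proj_surj y; rewrite -linearZ -(linear0 (quotmod_proj _)).
  apply/quotmod_projE; rewrite subr0; apply/asboolP; exists (p ^+ (k - a) * x).
  by rewrite -[in LHS](subnK ak) exprD mulrAC.
case: a ka => // a ka.
pose q : {linear R^o -> quotmod (principal (p ^+ a.+1))} := quotmod_proj _.
have q_eq0 (r : R) : q (r : R^o) = 0 <-> exists c, r = c * p ^+ a.+1.
  rewrite -(linear0 q); split=> [/quotmod_projE|h].
    by rewrite subr0 => /asboolP.
  by apply/quotmod_projE; rewrite subr0; apply/asboolP.
have qZ c (r : R) : c *: q r = q (c * r) by rewrite -linearZ.
have q_surj (u : quotmod (principal (p ^+ a.+1))) :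
    exists r : R, u = q r.
  by have [x ->] := quotmod_proj_surj u; exists x.
clearbody q; apply: (@has_length_eq _ _ (cyclic (q (p ^+ a : R^o)))).
  move=> u; apply/submod_ofP/power_socleP => [[c ->]|].
    split; first by rewrite !qZ; apply/q_eq0; exists c; rewrite exprS mulrCA.
    by exists (q (c * p ^+ (a - k))); rewrite !qZ mulrCA -exprD subnKC.
  have [x ->] := q_surj u; rewrite qZ => -[/q_eq0[c pxE] _].
  by exists c; rewrite qZ; congr (q _); apply: (mulfI p0); rewrite pxE exprS mulrCA.
apply: has_length_cyclic => //.
  by rewrite qZ; apply/q_eq0; exists 1; rewrite mul1r exprS.
apply/eqP => /q_eq0[c pE]; move: (p1 c).
rewrite -(inj_eq (mulfI (expf_neq0 a p0))).
by rewrite mulr1 [X in _ != X]pE exprSr mulrCA eqxx.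
Qed.

Lemma in_power_socle_pair k (M N : lmodType R) (x : M) (y : N) :
  ((x, y) \in power_socle k (M * N)%type) =
  (x \in power_socle k M) && (y \in power_socle k N).
Proof.
apply/power_socleP/andP => [[pxy [[u v] xyE]]|].
  have [px py] := (congr1 fst pxy, congr1 snd pxy).
  have [xE yE] := (congr1 fst xyE, congr1 snd xyE).
  by split; apply/power_socleP; split=> //; [exists u|exists v].
case=> /power_socleP[px [u def_x]] /power_socleP[py [v def_y]]; split.
  by rewrite -[RHS]/(0, 0) -px -py.
by exists (u, v); rewrite def_x def_y.
Qed.

Lemma has_length_power_socle_pair k (M N : lmodType R) a b :
  has_length (power_socle k M) a -> has_length (power_socle k N) b ->
  has_length (power_socle k (M * N)%type) (a + b).
Proof.
move=> ha hb; pose S := power_socle k (M * N)%type.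
apply: (has_length_add (f := (fst : {linear (M * N)%type -> M}))).
  apply: has_length_eq ha => x; apply/idP/imgP => [xM|[[u v] uvS ->]].
    by exists (x, 0); rewrite // in_power_socle_pair xM rpred0.
  by move: uvS; rewrite in_power_socle_pair => /andP[].
rewrite -[b]addn0.
apply: (has_length_add (f := (snd : {linear (M * N)%type -> N}))).
  apply: has_length_eq hb => y; apply/idP/imgP => [yN|[[u v] uvS ->]].
    by exists (0, y); rewrite // in_kernel in_power_socle_pair yN rpred0 eqxx.
  by move: uvS; rewrite in_kernel in_power_socle_pair => /andP[/andP[]].
apply: has_length0 => -[x y]; rewrite !in_kernel /=.
by case/andP=> /andP[_ /eqP->] /eqP->.
Qed.

(** Each cyclic summand contributes 1 if its part exceeds [k] and 0 otherwise; the transpose counts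
    the same parts. *)
Lemma has_length_power_socle_std k l : uniformizer ->
  has_length (power_socle k (std_module p l)) (conj_part l k.+1).
Proof.
move=> up; elim: l => [|a l IHl] /=.
  by apply: has_length0 => x _; rewrite [LHS]thinmx0.
apply: has_length_power_socle_pair => //.
exact: has_length_power_socle_principal.
Qed.

Lemma lmod_iso_power_socle k (M N : lmodType R) n : lmod_iso M N ->
  has_length (power_socle k N) n -> has_length (power_socle k M) n.
Proof.
case=> f [g fK gK] hN; rewrite -[n]addn0; apply: (has_length_add (f := f)).
  apply: has_length_eq hN => x.
  apply/power_socleP/imgP => [[px [y def_x]]|[z /power_socleP[pz [y def_z]] ->]].
    exists (g x); rewrite ?gK //; apply/power_socleP; split.
      by apply: (can_inj fK); rewrite linearZZ gK px linear0.
    by exists (g y); apply: (can_inj fK); rewrite linearZZ !gK.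
  split; first by rewrite -linearZ pz linear0.
  by exists (f y); rewrite -linearZ -def_z.
apply: has_length0 => x; rewrite in_kernel => /andP[_ /eqP fx].
by rewrite -(fK x) fx -(linear0 f) fK.
Qed.

Lemma has_type_power_socle k (M : lmodType R) l : uniformizer ->
  has_type p M l -> has_length (power_socle k M) (conj_part l k.+1).
Proof.
by move=> up [_ iso]; apply/(lmod_iso_power_socle iso)/has_length_power_socle_std.
Qed.

Lemma std_module_torsion l : exists n, forall x : std_module p l, p ^+ n *: x = 0.
Proof.
elim: l => [|a l [n IHl]] /=; first by exists 0%N => x; rewrite [LHS]thinmx0.
exists (a + n)%N => -[x y].
suff [hx hy] : p ^+ (a + n) *: x = 0 /\ p ^+ (a + n) *: y = 0.
  by rewrite -[RHS]/(0, 0) -[in RHS]hx -hy.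
rewrite exprD -!scalerA IHl scaler0; split=> //; rewrite scalerA mulrC -scalerA.
have [r ->] := quotmod_proj_surj x.
suff -> : p ^+ a *: quotmod_proj (principal (p ^+ a)) r = 0 by rewrite scaler0.
rewrite -linearZ -(linear0 (quotmod_proj (principal (p ^+ a)))).
apply/quotmod_projE; rewrite subr0; apply/asboolP; exists r.
exact: mulrC.
Qed.

Lemma has_type_torsion (M : lmodType R) l :
  has_type p M l -> exists n, forall x : M, p ^+ n *: x = 0.
Proof.
case=> _ [f [g fK _]]; have [n h] := std_module_torsion l.
by exists n => x; apply: (can_inj fK); rewrite linearZZ h linear0.
Qed.

Lemma has_type_finite_length (M : lmodType R) l :
  uniformizer -> has_type p M l -> finite_length (full M).
Proof.
move=> up tM; have [n pn0] := has_type_torsion tM.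
suff [m hm] : finite_length (power_mul p 0 (full M)).
  exists m; apply: has_length_eq hm => x; rewrite in_full.
  by apply/power_mulP; exists x; rewrite ?in_full ?expr0 ?scale1r.
have : finite_length (power_mul p n (full M)).
  by exists 0%N; apply: has_length0 => _ /power_mulP[y _ ->]; rewrite pn0.
(* Climb the filtration from its zero term up to exponent 0: multiplication by [p] maps the [n]-th
   power onto the next one, and its kernel there is the power socle, whose length is known from the
   type. *)
elim: n {pn0} => // n IHn [m hm]; apply: IHn.
exists (m + conj_part l n.+1)%N; apply: (has_length_add (f := *:%R p)).
  apply: has_length_eq hm => x; rewrite -(add1n n) power_mulD.
  by apply/power_mulP/imgP.
apply: has_length_eq (has_type_power_socle n up tM) => x.
by rewrite in_kernel in_socle expr1.
Qed.

End Uniformizer.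

(** * Duality *)

Section Factorization.
Variables (R : idomainType) (M N : lmodType R).

Section Lift.
Variables (A : submodClosed M) (f : {linear M -> N}).

Definition quotmod_lift of {in A, forall x, f x = 0} :=
  fun u : quotmod A => f (repr u).
Hypothesis fA0 : {in A, forall x, f x = 0}.

Lemma quotmod_liftE x : quotmod_lift fA0 (quotmod_proj A x) = f x.
Proof.
apply/eqP; rewrite -subr_eq0 -linearB fA0 //.
by apply/quotmod_projE; rewrite /quotmod_proj reprK.
Qed.

Fact quotmod_lift_linear : linear (quotmod_lift fA0).
Proof.
move=> a u v; have [x ->] := quotmod_proj_surj u.
have [y ->] := quotmod_proj_surj v.
by rewrite -linearP !quotmod_liftE linearP.
Qed.
HB.instance Definition _ := GRing.isLinear.Build R (quotmod A) N *:%R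
  (quotmod_lift fA0) quotmod_lift_linear.
End Lift.

Definition scale_by (x : M) (a : R^o) : M := (a : R) *: x.
Fact scale_by_linear x : linear (scale_by x).
Proof. by move=> a b c; rewrite /scale_by scalerDl scalerA. Qed.
HB.instance Definition _ x := GRing.isLinear.Build R R^o M *:%R
  (scale_by x) (scale_by_linear x).

End Factorization.

Section Annihilator.
Variables (R : idomainType) (E M : lmodType R).
Implicit Types (T : submodClosed M) (x : M) (f : dual E M).

Lemma dual_fun_linear f : linear (dual_fun f).
Proof. exact: (linearP (f : {linear M -> E})). Qed.
HB.instance Definition _ f := GRing.isLinear.Build R M E *:%R (dual_fun f)
  (dual_fun_linear f).

Lemma dual_funZ f a x : dual_fun f (a *: x) = a *: dual_fun f x.
Proof. exact: linearZZ. Qed.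

Definition dual_eval x f : E := dual_fun f x.
Fact dual_eval_linear x : linear (dual_eval x).
Proof. by []. Qed.
HB.instance Definition _ x := GRing.isLinear.Build R (dual E M) E *:%R
  (dual_eval x) (dual_eval_linear x).

Fact ann_closed T : lin_closed (fun f => {in T, forall x, dual_fun f x = 0}).
Proof.
split=> // a f g f0 g0 x xT.
by rewrite -[LHS]/(a *: dual_fun f x + dual_fun g x) f0 ?g0 // scaler0 addr0.
Qed.
Definition ann T : submodClosed (dual E M) := submod_of (ann_closed T).

Lemma annP T f : reflect {in T, forall x, dual_fun f x = 0} (f \in ann T).
Proof. exact: submod_ofP. Qed.

End Annihilator.

Section Duality.
Variables (R : idomainType) (p : R) (E : lmodType R).
Hypothesis p_unif : uniformizer p.
Hypothesis E_env : injective_envelope (quotmod (principal p)) E.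

Lemma quotmod_principal_eq0 (r : R) :
  quotmod_proj (principal p) (r : R^o) = 0 <-> exists c, r = c * p.
Proof.
rewrite -(linear0 (quotmod_proj (principal p))); split=> [/quotmod_projE|h].
  by rewrite subr0 => /asboolP.
by apply/quotmod_projE; rewrite subr0; apply/asboolP.
Qed.

(** The socle of [E] is simple, generated by the image of the class of 1: if [x] is nonzero and
    killed by [p], essentiality makes [cyclic x] meet the image of [i], and simplicity then puts [x]
    itself there. *)
Lemma envelope_socle : exists e : E,
  [/\ e != 0, p *: e = 0 & forall x : E, p *: x = 0 -> x \in cyclic e].
Proof.
have [_ [i [i_inj i_ess]]] := E_env; have [_ p1 p_max] := p_unif.
pose q1 := quotmod_proj (principal p) (1 : R^o); exists (i q1).
have iE u : exists r : R, i u = r *: i q1.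
  have [r ->] := quotmod_proj_surj u; exists r.
  by rewrite -!linearZZ /= /GRing.scale /= mulr1.
have pe : p *: i q1 = 0.
  rewrite -linearZZ -(linear0 i); congr (i _); rewrite -linearZ.
  by apply/quotmod_principal_eq0; exists 1; rewrite /GRing.scale /= mulr1 mul1r.
split=> //.
  rewrite -(linear0 i) (inj_eq i_inj).
  by apply/eqP => /quotmod_principal_eq0[c /esym/eqP]; apply/negP.
move=> x px; have [->|x0] := eqVneq x 0; first exact: rpred0.
have [|y yx [y0 /asboolP[u def_y]]] := i_ess (cyclic x).
  by exists x => //; apply/submod_ofP; exists 1; rewrite scale1r.
apply: (cyclic_simple p_unif px yx y0); have [r] := iE u.
by rewrite def_y => ->; apply/submod_ofP; exists r.
Qed.

(** The class of [x] modulo [T] spans a copy of the residue field. Injectivity of [E] extends the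
    embedding of that copy in [E] to the whole quotient by [T]. *)
Lemma dual_separates (M : lmodType R) (T : submodClosed M) x :
  p *: x \in T -> x \notin T -> exists2 f, f \in ann E T & dual_fun f x != 0.
Proof.
move=> pxT xT; have [E_inj [i [i_inj _]]] := E_env.
have [_ p1 p_max] := p_unif; pose q : {linear M -> quotmod T} := quotmod_proj T.
have qZ a : scale_by (q x) a = q (a *: x) by rewrite linearZZ.
have qx0 : {in principal p, forall r, scale_by (q x) r = 0}.
  move=> _ /asboolP[c ->]; rewrite qZ -(linear0 q).
  by apply/quotmod_projE; rewrite subr0 -scalerA rpredZ.
pose j := quotmod_lift qx0.
have j_inj : injective j.
  move=> u v; have [r ->] := quotmod_proj_surj u.
  have [s ->] := quotmod_proj_surj v.
  rewrite /j !quotmod_liftE /= !qZ => /quotmod_projE; rewrite -scalerBl => rsT.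
  apply/quotmod_projE/asboolP; have [//|[a [b abE]]] := p_max (r - s).
  case/negP: xT; rewrite -[x]scale1r -abE scalerDl -!scalerA.
  by apply: rpredD; apply: rpredZ.
have [g gE] := E_inj _ _ j i j_inj.
pose f : dual E M := (g \o q : {linear M -> E}).
exists f.
  apply/annP => t tT; rewrite -[LHS]/(g (q t)); suff -> : q t = 0 by rewrite linear0.
  by rewrite -(linear0 q); apply/quotmod_projE; rewrite subr0.
rewrite -[dual_fun f x]/(g (q x)).
have -> : q x = j (quotmod_proj (principal p) (1 : R^o)).
  by rewrite /j quotmod_liftE /= qZ scale1r.
rewrite gE -(linear0 i) (inj_eq i_inj).
by apply/eqP => /quotmod_principal_eq0[c /esym/eqP]; apply/negP.
Qed.

Section FiniteLength.
Variables (M : lmodType R) (n : nat).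
Hypothesis M_torsion : forall x : M, p ^+ n *: x = 0.
Hypothesis M_finite : finite_length (full M).

Lemma len_extension (T : submodClosed M) x :
  p *: x \in T -> x \notin T -> len (extension T x) = (len T).+1.
Proof.
move=> pxT xT; have fT' := finite_length_submod (extension T x) M_finite.
rewrite (len_add (quotmod_proj T) fT') -add1n; congr (_ + _)%N.
  apply: has_length_len.
  apply: (@has_length_eq _ _ (cyclic (quotmod_proj T x))).
    move=> u; apply/submod_ofP/imgP => [[c ->]|[y /submod_ofP[c yT] ->]].
      exists (c *: x); last by rewrite linearZ.
      by apply/submod_ofP; exists c; rewrite subrr rpred0.
    by exists c; rewrite -linearZ; apply/quotmod_projE.
  apply: has_length_cyclic p_unif _ _.
    by rewrite -linearZ -(linear0 (quotmod_proj T)); apply/quotmod_projE; rewrite subr0.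
  apply: contra xT; rewrite -(linear0 (quotmod_proj T)) => /eqP/quotmod_projE.
  by rewrite subr0.
apply: eq_len => y; rewrite in_kernel; apply/andP/idP => [[_]|yT].
  by rewrite -(linear0 (quotmod_proj T)) => /eqP/quotmod_projE; rewrite subr0.
split; first by apply/submod_ofP; exists 0; rewrite scale0r subr0.
by rewrite -(linear0 (quotmod_proj T)); apply/eqP/quotmod_projE; rewrite subr0.
Qed.

(** Induction on the colength of [T]. Adjoin to [T] some [x] outside it with [p *: x] in [T]:
    evaluation at [x] maps [ann E T] onto the simple socle of [E], and its kernel is the annihilator
    of the enlarged submodule. *)
Lemma has_length_ann (T : submodClosed M) :
  has_length (ann E T) (len (full M) - len T).
Proof.
have [d] := ubnP (len (full M) - len T); elim: d T => // d IHd T /ltnSE leTd.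
have [Tfull|/existsNP[x0 /negP x0T]] := pselect (forall x, x \in T).
  have -> : len T = len (full M) by apply: eq_len => x; rewrite Tfull in_full.
  rewrite subnn; apply: has_length0 => f /annP f0; apply: dualP => x.
  by rewrite f0.
(* Torsion brings some [p ^+ k *: x0] into [T]; for the least such [k], which is positive, the
   preceding multiple is the desired [x]. *)
have [x pxT xT] : exists2 x, p *: x \in T & x \notin T.
  have exT : exists k, p ^+ k *: x0 \in T by exists n; rewrite M_torsion rpred0.
  case: (ex_minnP exT) => -[|k] pkT k_min.
    by rewrite scale1r (negPf x0T) in pkT.
  exists (p ^+ k *: x0); first by rewrite scalerA -exprS.
  by apply/negP => /k_min; rewrite ltnn.
have lenT := len_extension pxT xT.
have lenT_le : (len (extension T x) <= len (full M))%N.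
  by apply: len_le => // y _; exact: in_full.
have [e [e0 pe e_max]] := envelope_socle.
have -> : (len (full M) - len T =
           1 + (len (full M) - len (extension T x)))%N by lia.
apply: (has_length_add (f := dual_eval x)).
  apply: has_length_eq (has_length_cyclic p_unif pe e0).
  have sub : {subset img (dual_eval x) (ann E T) <= cyclic e}.
    move=> _ /imgP[f /annP fT ->]; apply: e_max.
    by rewrite -[LHS]dual_funZ fT.
  move=> y; apply/idP/idP => [/submod_ofP[c ->]|/sub//].
  have [f fT fx] := dual_separates pxT xT.
  have fxI : dual_fun f x \in img (dual_eval x) (ann E T) by apply/imgP; exists f.
  by rewrite rpredZ // (cyclic_simple p_unif pe (sub _ fxI) fx).
have hd : (len (full M) - len (extension T x) < d)%N by lia.
apply: has_length_eq (IHd _ hd) => f; rewrite in_kernel.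
apply/annP/andP => [fT|[/annP fT /eqP fx] y /submod_ofP[c /fT]].
  split; last first.
    by apply/eqP/fT/submod_ofP; exists 1; rewrite scale1r subrr rpred0.
  by apply/annP => y yT; apply/fT/submod_ofP; exists 0; rewrite scale0r subr0.
by rewrite linearB /= dual_funZ [dual_fun f x]fx scaler0 subr0.
Qed.

Lemma len_power_mul_quot_ann (T : submodClosed M)
    (K : submodClosed (dual E M)) k :
  K =i ann E T ->
  finite_length (full (quotmod K)) /\
  len (power_mul p k (full (quotmod K))) = len (power_mul p k T).
Proof.
move=> KT; have fD : finite_length (full (dual E M)).
  exists (len (full M) - len (cyclic (0 : M)))%N.
  apply: has_length_eq (has_length_ann (cyclic 0)) => f; rewrite in_full.
  by apply/annP => _ /submod_ofP[c ->]; rewrite scaler0 linear0.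
have lenD : len (full (dual E M)) = len (full M).
  rewrite -[RHS]subn0 -(has_length_len (@has_length0 _ _ (cyclic (0 : M)) _)).
    rewrite -(has_length_len (has_length_ann (cyclic 0))); apply: eq_len => f.
    rewrite in_full; apply/esym/annP => _ /submod_ofP[c ->].
    by rewrite scaler0 linear0.
  by move=> _ /submod_ofP[c ->]; rewrite scaler0.
pose q : {linear dual E M -> quotmod K} := quotmod_proj K; split.
  case: (finite_length_img q fD) => r hr; exists r.
  apply: has_length_eq hr => u; rewrite in_full; apply/imgP.
  by have [f ->] := quotmod_proj_surj u; exists f; rewrite ?in_full.
have lenT : (len (power_mul p k T) <= len (full M))%N.
  by apply: len_le => // y _; exact: in_full.
(* The image of [g] is the [k]-th power of the quotient, and its kernel is the annihilator of
   [power_mul p k T]; the result is additivity of length along [g]. *)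
pose g : {linear dual E M -> quotmod K} := q \o ( *:%R (p ^+ k)).
have := len_add g fD; rewrite lenD.
have -> : len (img g (full (dual E M))) =
          len (power_mul p k (full (quotmod K))).
  apply: eq_len => u; apply/imgP/power_mulP => [[f _ ->]|[v _ ->]].
    by exists (q f); rewrite ?in_full // -linearZ.
  have [f ->] := quotmod_proj_surj v; exists f; rewrite ?in_full //.
  by rewrite -linearZ.
suff -> : len (kernel g (full (dual E M))) =
          (len (full M) - len (power_mul p k T))%N by lia.
rewrite -(has_length_len (has_length_ann _)); apply: eq_len => f.
rewrite in_kernel in_full /=; apply/eqP/annP.
  rewrite -(linear0 q) => /quotmod_projE; rewrite subr0 KT => /annP fT.
  by move=> _ /power_mulP[x xT ->]; rewrite linearZZ -(fT x xT).
move=> fT; rewrite -(linear0 q); apply/quotmod_projE; rewrite subr0 KT.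
apply/annP => x xT; rewrite -[LHS]dual_funZ fT //.
by apply/power_mulP; exists x.
Qed.

End FiniteLength.

(** For the harder inclusion, a form [f] killing the inverse image of [A] under [p ^+ l] factors
    through the quotient by it. Multiplication by [p ^+ l] embeds that quotient in [B / A], and
    injectivity of [E] extends the factored form to [g] on [B / A], so that [f] is [p ^+ l] times
    the pullback of [g]. *)
Lemma power_mul_dual (X : embedding R) l :
  power_mul p l (submod (dual_embedding E X)) =i
  ann E (inverse_image ( *:%R (p ^+ l)) (full (ambient X)) (submod X)).
Proof.
case: X => B A /= f; have [E_inj _] := E_env.
pose q : {linear B -> quotmod A} := quotmod_proj A.
pose Al := inverse_image ( *:%R (p ^+ l)) (full B) A.
apply/power_mulP/annP => [[_ /asboolP[g ->] ->] x|f0].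
  rewrite in_inverse_image => /andP[_ pxA].
  rewrite -[LHS]/(p ^+ l *: dual_fun g (q x)) -!linearZZ.
  suff -> : q (p ^+ l *: x) = 0 by rewrite linear0.
  by rewrite -(linear0 q); apply/quotmod_projE; rewrite subr0.
pose h : {linear B -> quotmod A} := q \o ( *:%R (p ^+ l)).
have hE x : h x = q (p ^+ l *: x) by [].
have q_eq0 x : q x = 0 <-> x \in A.
  by rewrite -(linear0 q); split=> [/quotmod_projE|xA];
    [rewrite subr0 | apply/quotmod_projE; rewrite subr0].
have h0 : {in Al, forall x, h x = 0}.
  by move=> x; rewrite in_inverse_image => /andP[_ /q_eq0].
pose j : {linear quotmod Al -> quotmod A} := quotmod_lift h0.
have jE x : j (quotmod_proj Al x) = h x by exact: quotmod_liftE.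
have j_inj : injective j.
  move=> u v; have [x ->] := quotmod_proj_surj u.
  have [y ->] := quotmod_proj_surj v; rewrite !jE => hxy.
  apply/quotmod_projE; rewrite in_inverse_image in_full; apply/q_eq0.
  by rewrite -hE linearB hxy subrr.
have [g gE] := E_inj _ _ j (quotmod_lift f0) j_inj.
exists (dual_map E q (g : dual E (quotmod A))); first by apply/asboolP; exists g.
apply: dualP => x; rewrite -[LHS](quotmod_liftE f0) -gE jE hE.
by rewrite 2!linearZZ.
Qed.

End Duality.

(** * Tableaux *)

Lemma conj_part_le_size l r : (conj_part l r <= size l)%N.
Proof. exact: count_size. Qed.

(** Since the parts decrease, the columns reaching a given row form an initial segment. *)
Lemma in_diagram_conj_part l row col :
  is_partition l -> (0 < row)%N ->
  in_diagram l row col = (col < conj_part l row)%N.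
Proof.
case/andP=> l_sorted _ row0; rewrite /in_diagram row0 /=.
elim: l l_sorted col => [|a l IHl] //= al col.
have IH := IHl (path_sorted al).
have al_le : all (geq a) l.
  by apply: order_path_min al => x y z /= yx xz; apply: leq_trans xz yx.
have [ra|ar] := leqP row a.
  by case: col => [|col] /=; rewrite ?ra // add1n ltnS IH.
rewrite add0n (_ : conj_part l row = 0%N).
  rewrite ltn0; case: col => [|col] /=; first by rewrite leqNgt ar.
  rewrite ltnS; apply/negbTE; rewrite negb_and -implybE; apply/implyP => cl.
  rewrite -ltnNge; apply: leq_ltn_trans ar.
  by apply: (allP al_le); rewrite mem_nth.
apply/eqP; rewrite -leqn0 leqNgt -has_count; apply/hasPn => x xl.
by rewrite -ltnNge; apply: leq_ltn_trans ar; apply: (allP al_le).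
Qed.

Lemma skew_row_conj_part outer inner row :
  is_partition outer -> is_partition inner -> (0 < row)%N ->
  skew_row outer inner row = (conj_part outer row - conj_part inner row)%N.
Proof.
move=> ho hi row0.
have count_iota n a b :
    count (fun c => (c < a) && ~~ (c < b))%N (iota 0 n) = (minn n a - b)%N.
  elim: n => [|n IHn]; first by rewrite min0n sub0n.
  by rewrite -addn1 iotaD count_cat IHn /= !add0n addn0; lia.
rewrite /skew_row -[in RHS](minn_idPr (conj_part_le_size outer row)).
rewrite -count_iota; apply: eq_count => c.
by rewrite !in_diagram_conj_part.
Qed.

(** * Row counts of the socle tableau *)

Section Tableaux.
Variables (R : idomainType) (p : R) (B : lmodType R) (A : submodClosed B).
Variable beta : seq nat.
Hypothesis p_unif : uniformizer p.
Hypothesis B_type : has_type p B beta.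

Let B_finite : finite_length (full B) := has_type_finite_length p_unif B_type.

Local Notation fin := (finite_length_submod _ B_finite).

Definition meet_power k : submodClosed B :=
  inverse_image idfun A (power_mul p k (full B)).

Lemma in_meet_power k x :
  (x \in meet_power k) = (x \in A) && (x \in power_mul p k (full B)).
Proof. exact: in_inverse_image. Qed.

(* [v e k] of the header *)
Definition layer_len e k : nat :=
  len (power_mul p e (socle p e.+1 (meet_power k))).

(** Additivity along multiplication by [p ^+ e], whose kernel is the next smaller socle. *)
Lemma len_socleS e k : len (socle p e.+1 (meet_power k)) =
  (layer_len e k + len (socle p e (meet_power k)))%N.
Proof.
rewrite (len_power_socle p e fin); congr (_ + _)%N; apply: eq_len => x.
rewrite !in_socle; case: (x \in _) => //=; apply/andP/idP => [[]//|/eqP pex].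
by rewrite pex exprS -scalerA pex scaler0.
Qed.

Lemma meet_powerS k : {subset meet_power k.+1 <= meet_power k}.
Proof.
move=> x; rewrite !in_meet_power => /andP[-> /power_mulP[y _ ->]].
by rewrite exprSr -scalerA; apply/power_mulP; exists (p *: y); rewrite ?in_full.
Qed.

Lemma layer_lenS e k : (layer_len e k.+1 <= layer_len e k)%N.
Proof.
apply: len_le fin => _ /power_mulP[x + ->]; rewrite in_socle => /andP[xk px].
by apply/power_mulP; exists x; rewrite // in_socle meet_powerS.
Qed.

Lemma layer_len_eventually :
  exists n, forall e k, (n <= k)%N -> layer_len e k = 0%N.
Proof.
have [n pn0] := has_type_torsion B_type; exists n => e k nk.
apply/has_length_len/has_length0 => _ /power_mulP[x + ->].
rewrite in_socle in_meet_power => /andP[/andP[_ /power_mulP[y _ ->]] _].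
by rewrite -[in p ^+ k](subnK nk) exprD -scalerA pn0 !scaler0.
Qed.

Lemma len_power_mul_quot (S : submodClosed B) k :
  (len (power_mul p k (full (quotmod S))) +
   len (inverse_image idfun S (power_mul p k (full B))))%N =
  len (power_mul p k (full B)).
Proof.
have fB := finite_length_submod (power_mul p k (full B)) B_finite.
rewrite (len_add (quotmod_proj S) fB).
congr (_ + _)%N; apply: eq_len => x.
  apply/power_mulP/imgP => [[v _ ->]|[_ /power_mulP[y _ ->] ->]].
    have [y ->] := quotmod_proj_surj v; exists (p ^+ k *: y).
      by apply/power_mulP; exists y; rewrite ?in_full.
    by rewrite linearZ.
  by exists (quotmod_proj S y); rewrite ?in_full // linearZ.
rewrite in_inverse_image in_kernel andbC; congr (_ && _).
rewrite -(linear0 (quotmod_proj S)); apply/idP/eqP => [xS|/quotmod_projE].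
  by apply/quotmod_projE; rewrite subr0.
by rewrite subr0.
Qed.

Lemma len_power_mul_type (M : lmodType R) l k :
  has_type p M l ->
  len (power_mul p k (full M)) =
  (len (power_mul p k.+1 (full M)) + conj_part l k.+1)%N.
Proof.
move=> tM; rewrite (len_power_mulS p k (has_type_finite_length p_unif tM)).
by rewrite (has_length_len (has_type_power_socle k p_unif tM)).
Qed.

(** Intersecting the socle of [A] with a power of [B] gives the socle of [meet_power], so
    [len_power_mul_quot] at [k] and [k.+1] gives both parts by subtraction. The additive form avoids
    truncated differences. *)
Lemma conj_part_socle_quot e s k :
  has_type p (quotmod (socle p e A)) s ->
  (conj_part s k.+1 + len (socle p e (meet_power k)) =
   conj_part beta k.+1 + len (socle p e (meet_power k.+1)))%N.
Proof.
move=> ts; have := len_power_mul_type k ts; have := len_power_mul_type k B_type.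
have capE j : len (inverse_image idfun (socle p e A) (power_mul p j (full B))) =
              len (socle p e (meet_power j)).
  by apply: eq_len => x; rewrite in_inverse_image !in_socle in_meet_power andbAC.
have := len_power_mul_quot (socle p e A) k.
have := len_power_mul_quot (socle p e A) k.+1.
rewrite !capE; lia.
Qed.

Section SocleTableau.
Variable sigma : nat -> seq nat.
Hypothesis sigmaP : is_socle_tableau p (Embedding A) sigma.

Lemma mu_socleE e k :
  mu_socle sigma e.+1 k.+1 = (layer_len e k - layer_len e k.+1)%N.
Proof.
have [[p1 _] [p2 _]] := (sigmaP e, sigmaP e.+1).
rewrite /mu_socle skew_row_conj_part //=.
have := conj_part_socle_quot k (sigmaP e).
have := conj_part_socle_quot k (sigmaP e.+1).
rewrite !len_socleS /=; have := layer_lenS e k; lia.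
Qed.

Lemma mu_socle_fromE e k : mu_socle_from sigma e.+1 k.+1 = (layer_len e k)%:Z.
Proof.
have [n n0] := layer_len_eventually.
(* Rows below [k + n] are empty, since [n] kills [layer_len] from index [n] on; the finite sum left
   over telescopes. *)
rewrite /mu_socle_from -(fsbig_widen [set` index_iota k.+1 (k + n).+1]).
- rewrite -fsbig_seq ?iota_uniq //.
  have telescope d : \sum_(k.+1 <= j < (k + d).+1) (mu_socle sigma e.+1 j)%:Z =
      (layer_len e k)%:Z - (layer_len e (k + d))%:Z.
    elim: d => [|d IHd]; first by rewrite addn0 big_geq // subrr.
    rewrite addnS big_nat_recr /= ?IHd; last by lia.
    by rewrite mu_socleE; have := layer_lenS e (k + d); lia.
  by rewrite telescope (n0 _ (k + n)%N) ?leq_addl // subr0.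
- by move=> j /=; rewrite mem_index_iota => /andP[].
move=> j [/= kj]; rewrite mem_index_iota => /negP; rewrite kj /= -leqNgt => nj.
by case: j kj nj => // j kj nj; rewrite mu_socleE n0 //; lia.
Qed.

End SocleTableau.

(** * Row counts of the dual LR-tableau *)

Definition preim_power l : submodClosed B :=
  inverse_image ( *:%R (p ^+ l)) (full B) A.

Lemma in_preim_power l x : (x \in preim_power l) = (p ^+ l *: x \in A).
Proof. by rewrite in_inverse_image in_full. Qed.

(* [w l k] of the header *)
Definition dual_layer_len l k := len (socle p 1 (power_mul p k (preim_power l))).

(** This makes the natural-number difference in [mu_LR_dual] a true difference. *)
Lemma dual_layer_lenS l k : (dual_layer_len l k <= dual_layer_len l.+1 k)%N.
Proof.
apply: len_le fin => x; rewrite !in_socle => /andP[/power_mulP[y yA ->] ->].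
rewrite andbT; apply/power_mulP; exists y => //.
by move: yA; rewrite !in_preim_power exprS -scalerA => /rpredZ.
Qed.

(** If [x = p ^+ k *: y] is killed by [p], then [p ^+ l *: y = 0] because [l > k], so [y] lies in
    [preim_power l] automatically. *)
Lemma dual_layer_len_lt l k : (k < l)%N ->
  dual_layer_len l k = conj_part beta k.+1.
Proof.
move=> kl; rewrite -(has_length_len (has_type_power_socle k p_unif B_type)).
apply: eq_len => x; rewrite in_socle expr1; apply/andP/power_socleP.
  by case=> /power_mulP[y _ ->] /eqP pky; split=> //; exists y.
case=> px [y def_x]; split; last exact/eqP.
apply/power_mulP; exists y => //; rewrite in_preim_power.
have -> : l = (l - k.+1 + 1 + k)%N by lia.
by rewrite !exprD expr1 -!scalerA -def_x px scaler0 rpred0.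
Qed.

(** The two submodules coincide: [x = p ^+ (l + e) *: y] is rewritten as [p ^+ e *: z] with
    [z = p ^+ l *: y], which lies in [A] and in the [l]-th power of [B]. *)
Lemma dual_layer_len_ge l e : dual_layer_len l (l + e) = layer_len e l.
Proof.
apply: eq_len => x; rewrite in_socle expr1; apply/andP/power_mulP.
  case=> /power_mulP[y + ->] /eqP pley; rewrite in_preim_power => yA.
  exists (p ^+ l *: y); last by rewrite scalerA -exprD addnC.
  rewrite in_socle in_meet_power yA scalerA -exprD.
  rewrite addSnnS addnS exprS -scalerA addnC pley eqxx andbT /=.
  by apply/power_mulP; exists y; rewrite ?in_full.
case=> z; rewrite in_socle in_meet_power => /andP[/andP[zA /power_mulP[y _ def_z]]].
move=> /eqP pz ->; split; last by rewrite scalerA -exprS pz.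
apply/power_mulP; exists y; first by rewrite in_preim_power -def_z.
by rewrite def_z scalerA -exprD addnC.
Qed.

Section LRTableau.
Variables (E : lmodType R) (gamma : nat -> seq nat).
Hypothesis E_env : injective_envelope (quotmod (principal p)) E.
Hypothesis gammaP : is_LR_tableau p (dual_embedding E (Embedding A)) gamma.

(** By duality the powers of the quotient have the lengths of the powers of [preim_power l];
    consecutive differences are the transpose parts on one side and socle lengths on the other. *)
Lemma conj_part_dual l k : conj_part (gamma l) k.+1 = dual_layer_len l k.
Proof.
have [n pn0] := has_type_torsion B_type.
have lenE j := len_power_mul_quot_ann p_unif E_env pn0 B_finite j
  (power_mul_dual E_env (X := Embedding A) l).
have := len_power_mul_type k (gammaP l).
rewrite !(proj2 (lenE _)) (len_power_mulS p k fin) /dual_layer_len /preim_power /=.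
lia.
Qed.

Lemma mu_LR_dual l k :
  mu_LR gamma l.+1 k.+1 = (dual_layer_len l.+1 k - dual_layer_len l k)%N.
Proof.
have [[p1 _] [p2 _]] := (gammaP l.+1, gammaP l).
by rewrite /mu_LR skew_row_conj_part //= !conj_part_dual.
Qed.

End LRTableau.

End Tableaux.

Theorem mainTheorem6 (R : idomainType) (p : R) (E : lmodType R)
    (X : embedding R) (beta : seq nat) (sigma gamma : nat -> seq nat)
    (l m : nat) :
  is_dvr R ->
  generates_maximal_ideal p ->
  injective_envelope (quotmod (principal p)) E ->
  has_type p (ambient X) beta ->
  is_socle_tableau p X sigma ->
  is_LR_tableau p (dual_embedding E X) gamma ->
  (1 <= l)%N -> (1 <= m)%N ->
  (mu_LR gamma l m)%:Z =
    if (m < l)%N then 0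
    else if m == l then
      (conj_part beta m)%:Z - mu_socle_from sigma 1 m
    else
      mu_socle_from sigma (m - l) l.+1 - mu_socle_from sigma (m - l + 1) l.
Proof.
move=> dvr p_gen E_env; case: X => B A /= B_type sigmaP gammaP.
have p_unif := dvr_uniformizer dvr p_gen.
case: l m => // l [] // m _ _; rewrite ltnS eqSS.
rewrite (mu_LR_dual p_unif B_type E_env gammaP).
have monoS := dual_layer_lenS A p_unif B_type l m.
have [ml|lm|eq_ml] := ltngtP m l.
(* Both layers are the same part of the transpose of [beta], so they cancel. *)
- by rewrite !(dual_layer_len_lt _ p_unif B_type) ?subnn //; lia.
(* Both layers are now [layer_len] values, at [(m - l.+1, l.+1)] and [(m - l, l)], matching the two
   sums of rows. *)
- have -> : (m.+1 - l.+1 = (m - l.+1).+1)%N by lia.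
  rewrite addn1 !(mu_socle_fromE p_unif B_type sigmaP).
  rewrite -!dual_layer_len_ge addSnnS subnSK // subnKC; last exact: ltnW.
  by rewrite subzn.
(* On the diagonal the upper layer still lies in the range [k < l.+1], giving [beta], while the
   lower one is [layer_len 0 l]. *)
rewrite {m}eq_ml in monoS *; rewrite (mu_socle_fromE p_unif B_type sigmaP).
rewrite -dual_layer_len_ge addn0 subzn //.
  by rewrite (dual_layer_len_lt _ p_unif B_type).
by rewrite -(dual_layer_len_lt A p_unif B_type (ltnSn l)).
Qed.
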